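(* Let $n\ge 2$ be an integer and let $z_0,\dots,z_n$ be positive real numbers such that $2z_k<z_0+\cdots+z_n$ for every $k$ with $0\le k\le n$. Then there exists a non-degenerate $n$-simplex in $\mathbb{R}^n$ whose $n+1$ facets have $(n-1)$-dimensional volumes $z_0,\dots,z_n$.
   Context: An $n$-simplex in $\mathbb{R}^n$ is the convex hull of $n+1$ points (its vertices); it is non-degenerate if it is not contained in a hyperplane. Its facets are the $n+1$ convex hulls of $n$ of the vertices. The facet volumes are listed with multiplicity: the facet opposite to the $k$-th vertex (for a suitable labelling $0,\dots,n$ of the vertices) has $(n-1)$-dimensional volume $z_k$. *)

(* Defs.v *)
From HB Require Import structures.
From mathcomp Require Import all_boot all_order all_algebra.
From mathcomp Require Import all_classical all_reals all_analysis.

Set Implicit Arguments.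
Unset Strict Implicit.
Unset Printing Implicit Defensive.

Import Order.TTheory GRing.Theory Num.Theory.

Local Open Scope classical_set_scope.
Local Open Scope ring_scope.

Section lebesgue_tuple.
Context (R : realType).

Section lebesgue_cons.
Context (m : nat)
  (mu : {sigma_finite_measure set (m.-tuple (measurableTypeR R)) -> \bar R}).

Definition tuple_cons (p : measurableTypeR R * m.-tuple (measurableTypeR R)) :
  m.+1.-tuple (measurableTypeR R) := [the m.+1.-tuple _ of p.1 :: p.2].

Lemma measurable_tuple_cons : measurable_fun setT tuple_cons.
Proof. exact: measurable_cons. Qed.

Definition lebesgue_cons : set (m.+1.-tuple (measurableTypeR R)) -> \bar R :=
  pushforward (lebesgue_measure \x mu)%E tuple_cons.

Let lebesgue_cons0 : lebesgue_cons set0 = 0%E.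
Proof. by rewrite /lebesgue_cons /pushforward preimage_set0 measure0. Qed.

Let lebesgue_cons_ge0 A : (0 <= lebesgue_cons A)%E.
Proof. exact: integral_ge0. Qed.

Let lebesgue_cons_sigma_additive : semi_sigma_additive lebesgue_cons.
Proof.
move=> F mF tF mUF; rewrite /lebesgue_cons /pushforward preimage_bigcup.
have mp A : measurable A -> measurable (tuple_cons @^-1` A).
  by move=> mA; rewrite -[X in measurable X]setTI; exact: measurable_tuple_cons.
apply: measure_semi_sigma_additive.
- by move=> n; exact: mp.
- apply/trivIsetP => /= i j _ _ ij; rewrite -preimage_setI.
  by move/trivIsetP : tF => /(_ _ _ _ _ ij) ->//; rewrite preimage_set0.
- by rewrite -preimage_bigcup; exact: mp.
Qed.

HB.instance Definition _ := isMeasure.Build _ _ _ lebesgue_cons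
  lebesgue_cons0 lebesgue_cons_ge0 lebesgue_cons_sigma_additive.

Let lebesgue_cons_sigma_finite : sigma_finite setT lebesgue_cons.
Proof.
have /sigma_finiteP[F [TF ndF Foo]] :=
  sigma_finiteT (@lebesgue_measure R : {sigma_finite_measure set _ -> \bar R}).
have /sigma_finiteP[G [TG ndG Goo]] := sigma_finiteT mu.
pose u (x : m.+1.-tuple (measurableTypeR R)) := (tnth x ord0, behead_tuple x).
have mu' : measurable_fun setT u.
  apply/measurable_fun_pairP; split; first exact: measurable_tnth.
  exact: measurable_behead.
have uK p : u (tuple_cons p) = p.
  by case: p => t x; congr pair; apply: val_inj.
exists (fun i => u @^-1` (F i `*` G i)).
  rewrite -preimage_bigcup; apply/seteqP; split => // x _ /=.
  have [i _ Fi] : (\bigcup_i F i) (u x).1 by rewrite -TF.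
  have [j _ Gj] : (\bigcup_i G i) (u x).2 by rewrite -TG.
  exists (maxn i j) => //; split.
    by move: Fi; exact/subsetPset/ndF/leq_maxl.
  by move: Gj; exact/subsetPset/ndG/leq_maxr.
move=> i; have [? ?] := Foo i; have [? ?] := Goo i; split.
  by rewrite -[X in measurable X]setTI; apply: mu' => //; exact: measurableX.
rewrite /lebesgue_cons /pushforward.
rewrite (_ : tuple_cons @^-1` _ = F i `*` G i); last first.
  by apply/funext => p; rewrite -[in RHS](uK p).
by rewrite product_measure1E// lte_mul_pinfty// ge0_fin_numE.
Qed.

HB.instance Definition _ :=
  Measure_isSigmaFinite.Build _ _ _ lebesgue_cons lebesgue_cons_sigma_finite.

End lebesgue_cons.

(* The m-dimensional Lebesgue measure, as the m-fold product of the
   one-dimensional one. *)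
Fixpoint lebesgue_tuple (m : nat) :
    {sigma_finite_measure set (m.-tuple (measurableTypeR R)) -> \bar R} :=
  match m with
  | 0%N => dirac [tuple]
  | m'.+1 => lebesgue_cons (lebesgue_tuple m')
  end.

Lemma lebesgue_tuple_box (m : nat) (a b : 'I_m -> R) :
  (forall i, a i <= b i) ->
  lebesgue_tuple m [set x | forall i, tnth x i \in `[a i, b i]%R] =
  (\prod_(i < m) (b i - a i))%:E.
Proof.
elim: m a b => [|m IH] a b ab /=.
  rewrite big_ord0 diracE mem_set//= => -[].
  by [].
rewrite /lebesgue_cons /pushforward.
rewrite (_ : _ @^-1` _ = `[a ord0, b ord0] `*`
    [set x : m.-tuple (measurableTypeR R) |
      forall i, tnth x i \in `[a (lift ord0 i), b (lift ord0 i)]%R]); last first.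
  apply/seteqP; split => -[t x] /= H.
    split; first exact: (H ord0).
    by move=> i; have := H (lift ord0 i); rewrite tnthS.
  move=> i; have [j ->|->] := unliftP ord0 i; last exact: H.1.
  by rewrite tnthS; exact: H.2.
rewrite product_measure1E//; last first.
  rewrite [X in measurable X](_ : _ = \bigcap_(i : 'I_m)
    ((fun x : m.-tuple (measurableTypeR R) => tnth x i) @^-1`
      `[a (lift ord0 i), b (lift ord0 i)])); last first.
    by apply/seteqP; split => [x H i _|x H i]; exact: H.
  apply: fin_bigcap_measurable => // i _.
  rewrite -[X in measurable X]setTI; apply: measurable_tnth => //.
rewrite [in X in (_ * X)%E]IH// big_ord_recl EFinM; congr (_ * _)%E.
rewrite [LHS]lebesgue_measure_itv/= lte_fin.
have := ab ord0; rewrite le_eqVlt => /orP[/eqP ->|->//].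
by rewrite ltxx subrr.
Qed.

End lebesgue_tuple.

Section geometry.
Context (R : realType).

(* The library norm on row vectors is the sup norm. *)
Definition enorm (m : nat) (x : 'rV[R]_m) : R :=
  Num.sqrt (\sum_(j < m) x ord0 j ^+ 2).

Definition euclidean_isometry (m n : nat) (f : 'rV[R]_m -> 'rV[R]_n) : Prop :=
  forall x y, enorm (f x - f y) = enorm (x - y).

(* m-dimensional volume of a Borel subset A of an isometric copy f(R^m) of R^m
   in R^n: the Lebesgue measure of A in the coordinates given by f. Since the
   Lebesgue measure is invariant under isometries of R^m, the value does not
   depend on f. *)
Definition has_volume (m n : nat) (A : set 'rV[R]_n) (v : R) : Prop :=
  exists f : 'rV[R]_m -> 'rV[R]_n,
    [/\ euclidean_isometry f, A `<=` range f &
        lebesgue_tuple R m [set x | A (f (\row_(j < m) tnth x j))] = v%:E].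

Definition conv_hull (m n : nat) (p : 'I_m -> 'rV[R]_n) : set 'rV[R]_n :=
  [set x | exists t : 'I_m -> R,
    [/\ forall i, 0 <= t i, \sum_(i < m) t i = 1 &
        x = \sum_(i < m) t i *: p i]].

Definition hyperplane (n : nat) (H : set 'rV[R]_n) : Prop :=
  exists (a : 'rV[R]_n) (b : R),
    a != 0 /\ H = [set x | \sum_(j < n) a ord0 j * x ord0 j = b].

Definition nondegenerate_simplex (n : nat) (p : 'I_n.+1 -> 'rV[R]_n) : Prop :=
  forall H, hyperplane H -> ~ conv_hull p `<=` H.

(* The facet opposite to p k; [lift k] enumerates the indices other than k. *)
Definition facet (n : nat) (p : 'I_n.+1 -> 'rV[R]_n) (k : 'I_n.+1) :
  set 'rV[R]_n := conv_hull (fun i : 'I_n => p (lift k i)).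

End geometry.

(* Main.v *)
Require Import Defs.
From mathcomp Require Import all_boot all_order all_algebra.
From mathcomp Require Import all_classical all_reals all_analysis.
From mathcomp Require Import perm ring lra.

Set Implicit Arguments.
Unset Strict Implicit.

Import Order.TTheory GRing.Theory Num.Theory.
Import numFieldNormedType.Exports.

Local Open Scope classical_set_scope.
Local Open Scope ring_scope.

(** The facets of a simplex have areas proportional to the lengths of vectors
    N_0, ..., N_n normal to them whose sum is zero. So the proof first finds
    vectors N_k of length z_k with sum zero, then the simplex with these
    normals, and finally rescales it.

    Vectors ([closed_polygon]). The hypothesis on z says that a closed polygon
    with sides z_0, ..., z_n exists; the point is to make n of the side vectors
    linearly independent in dimension n. Two sides a and b are replaced by a
    diagonal d ([diagonal_length]); the polygon with d in place of a and b is
    realized in one dimension less by induction, and d is then split into two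
    vectors of lengths a and b that leave the old space ([add_edge]).

    Simplex. If the rows N_1, ..., N_n form the matrix M, take the vertex p_0 at
    the origin and p_1, ..., p_n as the rows of c M^-T. Then N_i . p_j is c when
    i = j and 0 otherwise for i, j >= 1, so N_k is orthogonal to the facet
    opposite p_k for each k, including k = 0 where N_0 = - (N_1 + ... + N_n),
    and p_k lies at height c / z_k over that facet.

    Volumes ([has_volume_facet]). With D the absolute value of the determinant
    [simplex_det] (n! times the volume of the simplex), the facet opposite p_k
    has volume D / (h_k (n-1)!), where h_k is the height. For the simplex above
    D = c^n / |det M|, which gives z_k c^(n-1) / (|det M| (n-1)!), and c is
    chosen so that the factor of z_k is 1.

    The facet formula comes from Gram-Schmidt orthonormalization: in suitable
    orthonormal coordinates of the hyperplane of the facet, the edge vectors are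
    the rows of a triangular matrix T. A simplex with triangular edges is cut by
    a hyperplane orthogonal to the first axis in a simplex of the same kind, so
    its Lebesgue measure is computed by induction on the dimension
    ([lebesgue_tuple_simplex]). *)

(** * Orthonormalization *)

Lemma gram_gt0 (R : rcfType) (n : nat) (w : 'rV[R]_n) :
  w != 0 -> 0 < (w *m w^T) ord0 ord0.
Proof.
move=> wn0; have [j wj] : exists j, w ord0 j != 0.
  by apply/rV0Pn.
rewrite !mxE (bigD1 j)//= mxE -expr2 ltr_wpDr ?exprn_even_gt0//.
by apply: sumr_ge0 => i _; rewrite mxE -expr2 sqr_ge0.
Qed.

Lemma det_triangular (R : comPzRingType) (m : nat) (T : 'M[R]_m) :
  (forall i j : 'I_m, (j < i)%N -> T i j = 0) -> \det T = \prod_i T i i.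
Proof.
move=> Tt; rewrite -det_tr det_trig; first by apply: eq_bigr => i _; rewrite mxE.
by apply/is_trig_mxP => i j ij; rewrite mxE Tt.
Qed.

(** The factor [T] is upper triangular, so that all edges but the first lie in
    the hyperplane where the first coordinate vanishes; this is the shape that
    slicing along the first coordinate needs. Hence the rows are orthonormalized
    from the last to the first. *)
Lemma gram_schmidt (R : rcfType) (m n : nat) (E : 'M[R]_(m, n)) : row_free E ->
  exists (T : 'M[R]_m) (Q : 'M[R]_(m, n)),
    [/\ E = T *m Q, Q *m Q^T = 1%:M,
        forall i j : 'I_m, (j < i)%N -> T i j = 0 & forall i, 0 < T i i].
Proof.
elim: m E => [|m IH] E fE.
  exists 0, 0; split=> [||[]//|[]//]; last by rewrite [LHS]flatmx0 [RHS]flatmx0.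
  by rewrite [LHS]flatmx0 [RHS]flatmx0.
rewrite -[m.+1]/(1 + m)%N in E fE *.
pose e := usubmx E; pose F := dsubmx E.
have EE : E = col_mx e F by rewrite vsubmxK.
have fF : row_free F.
  apply: inj_row_free => v vF.
  have : row_mx (0 : 'rV_1) v *m E = 0 by rewrite EE mul_row_col mul0mx add0r.
  by move/eqP; rewrite mulmx_free_eq0// row_mx_eq0 => /andP[_ /eqP].
have [T [Q [FE QQ Tt T0]]] := IH F fF.
pose w := e - e *m Q^T *m Q.
have uT : T \in unitmx.
  by rewrite unitmxE det_triangular// unitfE gt_eqF// prodr_gt0.
have wn0 : w != 0.
  apply/eqP => w0.
  have : row_mx (1%:M : 'M[R]_1) (- (e *m Q^T *m invmx T)) *m E = 0.
    rewrite EE mul_row_col mul1mx mulNmx FE mulmxA.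
    by rewrite mulmxKV.
  move/eqP; rewrite mulmx_free_eq0// row_mx_eq0 => /andP[/eqP/matrixP/(_ 0 0)].
  by rewrite !mxE eqxx => /eqP; rewrite oner_eq0.
(* [w] is the component of the first row orthogonal to the other rows. *)
have wQ : w *m Q^T = 0 by rewrite mulmxBl -(mulmxA _ Q) QQ mulmx1 subrr.
pose h := Num.sqrt ((w *m w^T) ord0 ord0).
have h0 : 0 < h by rewrite sqrtr_gt0 gram_gt0.
have hn0 : h != 0 by rewrite gt_eqF.
have ww : w *m w^T = (h ^+ 2)%:M.
  by rewrite sqr_sqrtr ?ltW ?gram_gt0// [LHS]mx11_scalar.
pose q := h^-1 *: w.
exists (block_mx h%:M (e *m Q^T) 0 T : 'M[R]_(1 + m)).
exists (col_mx q Q : 'M[R]_(1 + m, n)); split.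
- rewrite EE mul_block_col mul0mx add0r -FE; congr col_mx.
  by rewrite mul_scalar_mx /q scalerA divff// scale1r subrK.
- rewrite tr_col_mx mul_col_row QQ /q linearZ/= -!scalemxAl -!scalemxAr.
  rewrite ww wQ -[Q *m w^T]trmxK trmx_mul trmxK wQ trmx0 !scaler0.
  rewrite !scale_scalar_mx expr2 mulKf// mulVf//.
  by rewrite [RHS]scalar_mx_block.
- move=> i j; rewrite -[T in block_mx _ _ _ T]/T.
  case: (@splitP 1 m i) => i' ii; case: (@splitP 1 m j) => j' jj.
  + by rewrite ii jj !ord1.
  + by rewrite ii jj !ord1.
  + move=> _; have -> : i = rshift 1 i' by exact: val_inj.
    have -> : j = lshift m j' by exact: val_inj.
    by rewrite block_mxEdl mxE.
  + rewrite ii jj ltn_add2l => ji.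
    have -> : i = rshift 1 i' by exact: val_inj.
    have -> : j = rshift 1 j' by exact: val_inj.
    by rewrite block_mxEdr Tt.
- move=> i; case: (@splitP 1 m i) => i' ii.
    have -> : i = lshift m i' by exact: val_inj.
    by rewrite block_mxEul !ord1 mxE.
  have -> : i = rshift 1 i' by exact: val_inj.
  by rewrite block_mxEdr.
Qed.

(** Base times height. In the orthonormal basis formed by [u] and the rows of
    [Q] the matrix with rows [w] and [E] becomes block triangular, with diagonal
    blocks [T] and the signed height of [w] over the span of [E]. *)
Lemma det_height (R : rcfType) (m : nat) (E : 'M[R]_(m, 1 + m)) (T : 'M[R]_m)
    (Q : 'M[R]_(m, 1 + m)) (w u : 'rV[R]_(1 + m)) :
  E = T *m Q -> Q *m Q^T = 1%:M -> T \in unitmx ->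
  u *m u^T = 1%:M -> E *m u^T = 0 ->
  `|\det (col_mx w E)| = `|(w *m u^T) ord0 ord0| * `|\det T|.
Proof.
move=> EE QQ uT uu Eu.
have Qu : Q *m u^T = 0 by rewrite -[Q](mulKmx uT) -EE -mulmxA Eu mulmx0.
have uQ : u *m Q^T = 0 by rewrite -[LHS]trmxK trmx_mul trmxK Qu trmx0.
have dO : `|\det (col_mx u Q)| = 1.
  apply/eqP; rewrite -sqrp_eq1// -normrX expr2 -{2}det_tr -det_mulmx.
  by rewrite tr_col_mx mul_col_row uu uQ Qu QQ -scalar_mx_block det1 normr1.
rewrite -[LHS]mulr1 -{1}dO -(det_tr (col_mx u Q)) -normrM -det_mulmx.
rewrite tr_col_mx mul_col_row Eu EE -mulmxA QQ mulmx1 det_ublock.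
by rewrite normrM det_mx11.
Qed.

(** * Closed polygons in general position *)

(** For a vector s of length [d] in a hyperplane and a unit vector e normal to
    it, the vectors h e + g s and h e + (1 + g) s have lengths [b] and [a]: these
    are two sides of a non-degenerate triangle whose third side is s. *)
Lemma triangle_split (R : rcfType) (a b d : R) :
  0 < d -> a < b + d -> b < a + d -> d < a + b ->
  exists h g : R,
    [/\ h != 0, h ^+ 2 + g ^+ 2 * d ^+ 2 = b ^+ 2
      & h ^+ 2 + (1 + g) ^+ 2 * d ^+ 2 = a ^+ 2].
Proof.
move=> d0 abd bad dab; have dn0 : d != 0 by rewrite gt_eqF.
pose g := (a ^+ 2 - b ^+ 2 - d ^+ 2) / (2 * d ^+ 2).
have gE : g * (2 * d ^+ 2) = a ^+ 2 - b ^+ 2 - d ^+ 2.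
  by rewrite /g mulfVK// mulf_neq0 ?expf_neq0// pnatr_eq0.
have h0 : 0 < b ^+ 2 - g ^+ 2 * d ^+ 2.
  have d4 : 0 < 4 * d ^+ 2 by rewrite mulr_gt0 ?exprn_gt0.
  (* Heron's formula: both sides are 16 times the squared area. *)
  have heron : 4 * d ^+ 2 * (b ^+ 2 - g ^+ 2 * d ^+ 2) =
      (a + b + d) * (b + d - a) * ((a + d - b) * (a + b - d)).
    transitivity (4 * d ^+ 2 * b ^+ 2 - (g * (2 * d ^+ 2)) ^+ 2); first by ring.
    by rewrite gE; ring.
  rewrite -(pmulr_rgt0 _ d4) heron !mulr_gt0//; lra.
exists (Num.sqrt (b ^+ 2 - g ^+ 2 * d ^+ 2)), g.
rewrite sqr_sqrtr ?ltW//; split; first by rewrite gt_eqF// sqrtr_gt0.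
- by rewrite subrK.
- rewrite (_ : _ + _ = b ^+ 2 + d ^+ 2 + g * (2 * d ^+ 2)); last by ring.
  by rewrite gE; ring.
Qed.

(** The rows of [M] are all sides but one of a closed polygon; the remaining
    side is minus their sum, which has length [d]. That side is replaced by two
    sides of lengths [b] and [a], of which the first becomes a new row and the
    second is again minus the sum of the rows. As the triangle is
    non-degenerate, the new row leaves the old space, hence [M'] is
    invertible. *)
Lemma add_edge (R : rcfType) (m : nat) (a b d : R) (M : 'M[R]_m) :
  0 < d -> a < b + d -> b < a + d -> d < a + b -> M \in unitmx ->
  (const_mx 1 *m M) *m (const_mx 1 *m M)^T = (d ^+ 2)%:M :> 'M[R]_1 ->
  exists M' : 'M[R]_(1 + m),
    [/\ M' \in unitmx,
        row (lshift m ord0) M' *m (row (lshift m ord0) M')^T = (b ^+ 2)%:M,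
        forall i, row (rshift 1 i) M' *m (row (rshift 1 i) M')^T =
                  row i M *m (row i M)^T
      & (const_mx 1 *m M') *m (const_mx 1 *m M')^T = (a ^+ 2)%:M :> 'M[R]_1].
Proof.
move=> d0 abd bad dab uM dE.
have [h [g [hn0 hb ha]]] := triangle_split d0 abd bad dab.
pose s : 'rV_m := const_mx 1 *m M.
exists (block_mx h%:M (g *: s) 0 M); split.
- by rewrite unitmxE det_ublock det_scalar1 unitrM -unitmxE uM unitfE hn0.
- rewrite -row_usubmx block_mxEv col_mxKu row_id tr_row_mx mul_row_col.
  rewrite linearZ/= -scalemxAl -scalemxAr.
  rewrite dE tr_scalar_mx -scalar_mxM !scale_scalar_mx -raddfD/= -hb.
  by congr _%:M; ring.
- move=> i; rewrite -row_dsubmx block_mxEv col_mxKd row_row_mx row0.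
  by rewrite tr_row_mx mul_row_col trmx0 mulmx0 add0r.
- rewrite (_ : const_mx 1 = row_mx 1%:M (const_mx 1)); last first.
    by apply/rowP => j; rewrite !mxE; case: fintype.split => ?;
      rewrite !mxE ?ord1 ?eqxx.
  rewrite mul_row_block !mul1mx mulmx0 addr0 -/s -{2 4}[s]scale1r -scalerDl.
  rewrite tr_row_mx mul_row_col linearZ/= -scalemxAl -scalemxAr.
  rewrite dE tr_scalar_mx -scalar_mxM !scale_scalar_mx -raddfD/= -ha.
  by congr _%:M; ring.
Qed.

(** Each inequality required of [d] bounds it by a number from below or by
    [a + b] or the sum of the [z i] from above; the hypotheses imply that each
    lower bound is below each upper one. At least two lengths [z i] are needed,
    since each of them has to be smaller than their sum. *)
Lemma diagonal_length (R : realFieldType) (n : nat) (a b : R) (z : 'I_n.+2 -> R) :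
  0 < a -> 0 < b -> (forall k, 0 < z k) ->
  2 * a < a + (b + \sum_i z i) -> 2 * b < a + (b + \sum_i z i) ->
  (forall k, 2 * z k < a + (b + \sum_i z i)) ->
  exists d, [/\ 0 < d, [/\ a < b + d, b < a + d & d < a + b],
    2 * d < d + \sum_i z i & forall k, 2 * z k < d + \sum_i z i].
Proof.
move=> a0 b0 z0; set S := \sum_i z i => ha hb hz.
pose L := \big[Num.max/`|a - b|]_k (2 * z k - S).
pose U := Num.min (a + b) S.
have zS k : z k < S.
  have [j jk] : exists j, j != k.
    by exists (lift k ord0); rewrite eq_sym neq_lift.
  rewrite /S (bigD1 k)//= (bigD1 j)//= ltrDl ltr_wpDr//.
  by apply: sumr_ge0 => i _; exact: ltW.
have LU : L < U.
  apply/bigmax_ltP; split.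
    by rewrite lt_min !ltr_norml; apply/andP; split; apply/andP; split; lra.
  by move=> k _; rewrite lt_min; have := hz k; have := zS k; lra.
have Lab : `|a - b| <= L by exact: bigmax_ge_id.
have Lz k : 2 * z k - S <= L by exact: le_bigmax_cond.
have LabU : U <= a + b by rewrite ge_min lexx.
have US : U <= S by rewrite ge_min lexx orbT.
have [dL dU] : L < (L + U) / 2 /\ (L + U) / 2 < U by split; lra.
exists ((L + U) / 2); set d := _ / 2 in dL dU *.
have := le_lt_trans Lab dL; rewrite ltr_norml => /andP[? ?].
split; [|split| |]; try lra.
by move=> k; have := Lz k; lra.
Qed.

(** The sides are the rows of [M], of lengths [z i], and minus the sum of the
    rows, of length [a]. *)
Lemma closed_polygon (R : rcfType) (n : nat) (a : R) (z : 'I_n.+2 -> R) :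
  0 < a -> (forall k, 0 < z k) ->
  2 * a < a + \sum_i z i -> (forall k, 2 * z k < a + \sum_i z i) ->
  exists M : 'M[R]_n.+2,
    [/\ M \in unitmx,
        forall i, row i M *m (row i M)^T = (z i ^+ 2)%:M
      & (const_mx 1 *m M) *m (const_mx 1 *m M)^T = (a ^+ 2)%:M :> 'M[R]_1].
Proof.
elim: n a z => [|n IH] a z a0 z0; rewrite big_ord_recl => ha hz.
  (* A triangle: split the degenerate polygon d, -d of the real line. *)
  rewrite big_ord1 in ha hz; set d := z (lift ord0 ord0) in ha hz.
  have hb := hz ord0; have hd := hz (lift ord0 ord0); rewrite -/d in hb hd.
  have ud : d%:M \in @unitmx R 1 by rewrite unitmxE det_scalar1 unitfE gt_eqF// z0.
  pose D : 'M[R]_1 := d%:M.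
  have gramd : (const_mx 1 *m D) *m (const_mx 1 *m D)^T = (d ^+ 2)%:M :> 'M[R]_1.
    rewrite mul_mx_scalar linearZ/= -scalemxAl -scalemxAr; apply/matrixP => i j.
    by rewrite !ord1 !mxE big_ord1 !mxE !mulr1 -expr2.
  have [|||M [uM bM dM aM]] :=
    @add_edge _ _ a (z ord0) d d%:M (z0 _) _ _ _ ud gramd.
  1-3: lra.
  exists M; split=> // i; have [j ->|->] := unliftP ord0 i; last first.
    have e : ord0 = @lshift 1 1 ord0 by exact: val_inj.
    by rewrite [in LHS]e bM.
  have e : lift ord0 j = @rshift 1 _ j by exact: val_inj.
  rewrite [in LHS]e dM !ord1 row_id -/d -gramd -/D.
  by rewrite (_ : const_mx 1 = 1%:M) ?mul1mx//;
    apply/matrixP => ? ?; rewrite !mxE !ord1.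
have [d [d0 [abd bad dab] hd hzd]] :=
  diagonal_length a0 (z0 ord0) (fun k => z0 (lift ord0 k))
  ha (hz ord0) (fun k => hz (lift ord0 k)).
have [M0 [uM0 zM0 dM0]] := IH d _ d0 (fun k => z0 (lift ord0 k)) hd hzd.
have [M [uM bM zM aM]] := add_edge d0 abd bad dab uM0 dM0.
exists M; split=> // i; have [j ->|->] := unliftP ord0 i; last first.
  have e : ord0 = @lshift 1 n.+2 ord0 by exact: val_inj.
  by rewrite [in LHS]e bM.
have e : lift ord0 j = @rshift 1 _ j by exact: val_inj.
by rewrite [in LHS]e zM zM0.
Qed.

(** * Lebesgue measure of a simplex with triangular edges *)

(** The simplex with vertex [v] and edge vectors [s] times the rows of [E]. The
    size [s] and the vertex [v] are free because they vary along the slices. *)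
Definition based_simplex (R : realType) (m n : nat) (v : 'rV[R]_n)
    (E : 'M[R]_(m, n)) (s : R) : set 'rV[R]_n :=
  [set x | exists t : 'rV[R]_m,
    [/\ forall i, 0 <= t ord0 i, \sum_i t ord0 i <= s & x = v + t *m E]].

Lemma conv_hull_based (R : realType) (m n : nat) (p : 'I_m.+1 -> 'rV[R]_n) :
  conv_hull p =
  based_simplex (p ord0) (\matrix_i (p (lift ord0 i) - p ord0)) 1.
Proof.
(* Both sides are the point with barycentric coordinates c, t. *)
have shift (c : R) (t : 'I_m -> R) : c + \sum_i t i = 1 ->
    c *: p ord0 + \sum_i t i *: p (lift ord0 i) =
    p ord0 + (\row_i t i) *m \matrix_i (p (lift ord0 i) - p ord0).
  move=> /(canRL (addrK _)) ->; rewrite mulmx_sum_row scalerBl scale1r -addrA.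
  congr (_ + _); rewrite addrC scaler_suml -sumrB; apply: eq_bigr => i _.
  by rewrite !mxE rowK scalerBr.
apply/seteqP; split => [x [t [t0 t1 ->]]|x [t [t0 t1 ->]]].
  exists (\row_i t (lift ord0 i)); split; first by move=> i; rewrite mxE.
    rewrite -t1 big_ord_recl; under eq_bigr do rewrite mxE.
    by rewrite lerDr.
  by rewrite big_ord_recl shift// -t1 big_ord_recl.
pose c i := if unlift ord0 i is Some j then t ord0 j else 1 - \sum_j t ord0 j.
have c0 : c ord0 = 1 - \sum_j t ord0 j by rewrite /c unlift_none.
have cl j : c (lift ord0 j) = t ord0 j by rewrite /c liftK.
have sumc : c ord0 + \sum_j c (lift ord0 j) = 1.
  by rewrite c0 (eq_bigr _ (fun j _ => cl j)) subrK.
exists c; split; last 1 first.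
- rewrite big_ord_recl shift//; congr (_ + _ *m _).
  by apply/rowP => i; rewrite mxE cl.
- move=> i; have [j ->|->] := unliftP ord0 i; first by rewrite cl.
  by rewrite c0 subr_ge0.
- by rewrite big_ord_recl.
Qed.

(** As only the first edge has a nonzero first coordinate, fixing that
    coordinate to [u] fixes the coefficient [t] of the first edge. *)
Lemma slice_simplex (R : realType) (m : nat) (v : 'rV[R]_m.+1)
    (T : 'M[R]_m.+1) (s u : R) (x : m.-tuple R) :
  (forall i j : 'I_m.+1, (j < i)%N -> T i j = 0) -> 0 < T ord0 ord0 ->
  let t := (u - v ord0 ord0) / T ord0 ord0 in
  based_simplex v T s (\row_j tnth [tuple of u :: x] j) <->
  0 <= t /\
  based_simplex (\row_j (v ord0 (lift ord0 j) + t * T ord0 (lift ord0 j)))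
    (\matrix_(i, j) T (lift ord0 i) (lift ord0 j)) (s - t) (\row_j tnth x j).
Proof.
move=> Ttrig T0 t; have Tn0 : T ord0 ord0 != 0 by rewrite gt_eqF.
split => [[c [c0 cs /rowP xE]]|[t0 [c [c0 cs /rowP xE]]]].
  have c0E : c ord0 ord0 = t.
    have := xE ord0; rewrite !mxE tnth0 big_ord_recl big1 => [|i _]; last first.
      by rewrite Ttrig ?mulr0.
    by rewrite addr0 /t => ->; rewrite (addrC (v _ _)) addrK mulfK.
  split; first by rewrite -c0E.
  exists (\row_i c ord0 (lift ord0 i)); split.
  - by move=> i; rewrite mxE.
  - under eq_bigr do rewrite mxE.
    by move: cs; rewrite big_ord_recl c0E lerBrDl.
  - apply/rowP => j; have := xE (lift ord0 j).
    rewrite !mxE tnthS => ->; rewrite big_ord_recl c0E addrA; congr (_ + _).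
    by apply: eq_bigr => i _; rewrite !mxE.
pose d : 'rV_m.+1 := \row_i (if unlift ord0 i is Some j then c ord0 j else t).
have d0 : d ord0 ord0 = t by rewrite mxE unlift_none.
have dl j : d ord0 (lift ord0 j) = c ord0 j by rewrite mxE liftK.
exists d; split.
- by move=> i; have [j ->|->] := unliftP ord0 i; rewrite ?d0 ?dl.
- by rewrite big_ord_recl d0 -lerBrDl (eq_bigr _ (fun j _ => dl j)).
- apply/rowP => j; rewrite !mxE big_ord_recl d0.
  rewrite (eq_bigr _ (fun j _ => congr2 _ (dl j) erefl)).
  have [k ->|->] := unliftP ord0 j.
    have := xE k; rewrite !mxE tnthS => ->; rewrite addrA; congr (_ + _).
    by apply: eq_bigr => i _; rewrite !mxE.
  rewrite tnth0 big1 => [|i _]; last by rewrite Ttrig ?mulr0.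
  by rewrite addr0 /t divfK// addrC subrK.
Qed.

Lemma integral_deriv_poly (R : realType) (p : {poly R}) (a b : R) : a <= b ->
  (\int[@lebesgue_measure R]_(x in `[a, b]) (p^`().[x])%:E =
    (p.[b] - p.[a])%R%:E)%E.
Proof.
rewrite le_eqVlt => /predU1P[->|ab].
  by rewrite set_itv1 integral_set1 subrr.
rewrite (@continuous_FTC2 R (horner p^`()) (horner p))//.
- by apply: continuous_subspaceT; exact: continuous_horner.
- split.
  + by move=> x _; exact: derivable_horner.
  + by apply: cvg_at_right_filter; exact: continuous_horner.
  + by apply: cvg_at_left_filter; exact: continuous_horner.
- by move=> x _; rewrite derivE.
Qed.

Lemma integral_power (R : realType) (m : nat) (s v h c : R) : 0 <= s -> 0 < h ->
  (\int[@lebesgue_measure R]_(u in `[v, (v + s * h)%R])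
    ((s - (u - v) / h) ^+ m / m`!%:R * c)%R%:E =
   (s ^+ m.+1 / m.+1`!%:R * (h * c))%R%:E)%E.
Proof.
move=> s0 h0; have hn0 : h != 0 by rewrite gt_eqF.
pose q : {poly R} := (s + v / h)%:P - h^-1 *: 'X.
pose p := (- (h * c / m.+1`!%:R) : R) *: q ^+ m.+1.
have qE u : q.[u] = s - (u - v) / h by rewrite /q !hornerE; ring.
have dq : q^`() = (- h^-1)%:P.
  by rewrite /q derivB derivC derivZ derivX sub0r alg_polyC polyCN.
have dp : p^`() = (c / m`!%:R) *: q ^+ m.
  rewrite /p derivZ deriv_exp dq mul_polyC /= scalerMnl scalerA.
  congr (_ *: _); rewrite factS natrM.
  by field; rewrite hn0 nat1r !pnatr_eq0 -lt0n fact_gt0.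
transitivity (p.[v + s * h] - p.[v])%:E.
  rewrite -integral_deriv_poly ?lerDl ?mulr_ge0 ?(ltW h0)//.
  apply: eq_integral => u _; rewrite dp hornerZ horner_exp qE.
  by congr _%:E; ring.
rewrite /p !hornerZ !horner_exp !qE subrr mul0r subr0.
rewrite (_ : s - (v + s * h - v) / h = 0); last by field.
by rewrite expr0n /=; congr _%:E; ring.
Qed.

(** By [slice_simplex] the slice at height [u] is a simplex with triangular
    edges of size [s - t u], empty unless [0 <= t u <= s], where [t u] is affine
    in [u]; so the measure is the integral of a power of an affine function. *)
Lemma lebesgue_tuple_simplex (R : realType) (m : nat) (v : 'rV[R]_m)
    (T : 'M[R]_m) (s : R) :
  (forall i j : 'I_m, (j < i)%N -> T i j = 0) -> (forall i, 0 < T i i) ->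
  0 <= s ->
  lebesgue_tuple R m [set x | based_simplex v T s (\row_j tnth x j)] =
  (s ^+ m / m`!%:R * \prod_i T i i)%:E.
Proof.
elim: m v T s => [|m IH] v T s Ttrig T0 s0.
  rewrite /= diracE mem_set /=; first by rewrite big_ord0 expr0 divr1 mulr1.
  exists 0; split; first by move=> i; rewrite mxE.
  - by rewrite big_ord0.
  - by apply/rowP => -[].
pose T' := \matrix_(i, j) T (lift ord0 i) (lift ord0 j).
pose t u := (u - v ord0 ord0) / T ord0 ord0.
rewrite [LHS]/= /lebesgue_cons /pushforward /product_measure1.
transitivity (\int[@lebesgue_measure R]_(u in
    `[v ord0 ord0, (v ord0 ord0 + s * T ord0 ord0)%R])
    ((s - t u) ^+ m / m`!%:R * \prod_i T' i i)%R%:E)%E; last first.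
  rewrite integral_power// big_ord_recl; congr (_ * (_ * _))%:E.
  by apply: eq_bigr => i _; rewrite mxE.
rewrite [RHS]integral_mkcond; apply: eq_integral => u _ /=; rewrite patchE.
have tIs : (u \in `[v ord0 ord0, v ord0 ord0 + s * T ord0 ord0]) =
    (0 <= t u <= s).
  rewrite in_itv/= /t ler_pdivlMr// ler_pdivrMr// mul0r subr_ge0.
  by rewrite lerBlDl.
rewrite mem_setE tIs; case: ifPn => [/andP[tu0 tus]|uI].
  rewrite -(IH (\row_j (v ord0 (lift ord0 j) + t u * T ord0 (lift ord0 j)))).
  - congr (lebesgue_tuple _ _ _); apply/seteqP; split => x.
      by rewrite /xsection /= inE/= => /(slice_simplex _ _ _ _ Ttrig (T0 _))[].
    move=> ?; rewrite /xsection /= inE/=.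
    exact/(slice_simplex _ _ _ _ Ttrig (T0 _)).
  - by move=> i j ji; rewrite mxE Ttrig.
  - by move=> i; rewrite mxE.
  - by rewrite subr_ge0.
rewrite (_ : xsection _ _ = set0) ?measure0//; apply/seteqP; split => // x.
rewrite /xsection /= inE/= => /(slice_simplex _ _ _ _ Ttrig (T0 _))[tu0].
move=> [c [c0 cs _]]; move: uI; rewrite tu0/= -subr_ge0 => /negP; apply.
by apply: le_trans cs; apply: sumr_ge0.
Qed.

(** * Volumes of facets *)

Lemma enormE (R : realType) (n : nat) (x : 'rV[R]_n) :
  enorm x = Num.sqrt ((x *m x^T) ord0 ord0).
Proof.
by rewrite mxE; congr Num.sqrt; apply: eq_bigr => j _; rewrite mxE expr2.
Qed.

Lemma has_volume_simplex (R : realType) (m n : nat) (v : 'rV[R]_n)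
    (T : 'M[R]_m) (Q : 'M[R]_(m, n)) :
  Q *m Q^T = 1%:M -> (forall i j : 'I_m, (j < i)%N -> T i j = 0) ->
  (forall i, 0 < T i i) ->
  has_volume m (based_simplex v (T *m Q) 1) (\det T / m`!%:R).
Proof.
move=> QQ Ttrig T0; exists (fun x => v + x *m Q); split.
- move=> x y; rewrite (addrC v (x *m Q)) addrKA -mulmxBl !enormE trmx_mul.
  by rewrite mulmxA -(mulmxA _ Q) QQ mulmx1.
- by move=> _ [t [_ _ ->]]; exists (t *m T) => //; rewrite mulmxA.
- rewrite -[RHS]/(_%:E) (_ : _ / _ = 1 ^+ m / m`!%:R * \prod_i T i i); last first.
    by rewrite expr1n mul1r mulrC det_triangular.
  rewrite -(lebesgue_tuple_simplex 0)//; congr (lebesgue_tuple _ _ _).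
  apply/seteqP; split => x /= [t [t0 t1 xE]]; exists t; split => //.
    rewrite add0r -[LHS]mulmx1 -QQ mulmxA.
    by move/addrI : xE => ->; rewrite !mulmxA -(mulmxA _ Q) QQ mulmx1.
  by rewrite xE add0r mulmxA.
Qed.

(** The signed volume of the simplex multiplied by n!, in a form that is
    symmetric in the vertices up to sign. *)
Definition simplex_det (R : realType) (n : nat) (p : 'I_n.+1 -> 'rV[R]_n) : R :=
  \det (\matrix_i row_mx (1%:M : 'M[R]_1) (p i) : 'M[R]_(1 + n)).

(** A hyperplane a . x = b containing all vertices would put the nonzero column
    (-b, a) in the kernel of the matrix of [simplex_det]. *)
Lemma nondegenerate_simplex_det (R : realType) (n : nat)
    (p : 'I_n.+1 -> 'rV[R]_n) : simplex_det p != 0 -> nondegenerate_simplex p.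
Proof.
rewrite -unitfE -unitmxE; set A := (X in X \in _) => uA H [a [b [an0 ->]]] sub.
have pab i : p i *m a^T = b%:M.
  have /sub/= <- : conv_hull p (p i).
    exists (fun j => (j == i)%:R); split.
    - by move=> j; rewrite ler0n.
    - by rewrite (bigD1 i)//= eqxx big1 ?addr0// => j /negPf ->.
    - rewrite (bigD1 i)//= eqxx scale1r big1 ?addr0// => j /negPf ->.
      by rewrite scale0r.
  rewrite [LHS]mx11_scalar mxE; congr (_%:M); apply: eq_bigr => j _.
  by rewrite mxE mulrC.
have : A *m col_mx (- b)%:M a^T = 0.
  apply/row_matrixP => i; rewrite row_mul rowK mul_row_col mul1mx pab row0.
  by rewrite -raddfD addNr raddf0.
move=> /(congr1 (mulmx (invmx A))); rewrite mulKmx// mulmx0.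
move=> /(congr1 (@dsubmx _ 1 n 1)); rewrite col_mxKd linear0.
by move=> /(congr1 trmx) /eqP; rewrite trmxK trmx0; exact/negP.
Qed.

(** Reorder the rows of the matrix of [simplex_det] so that [b] and [p k] come
    first, and subtract the row of [b] from all the others. *)
Lemma simplex_det_edges (R : realType) (m : nat) (p : 'I_m.+2 -> 'rV[R]_m.+1)
    (k : 'I_m.+2) (b := p (lift k ord0)) :
  `|\det (col_mx (p k - b) (\matrix_(i < m) (p (lift k (lift ord0 i)) - b)) : 'M[R]_(1 + m))|
  = `|simplex_det p|.
Proof.
rewrite /simplex_det; set A := (X in `|\det X| = _); set B := (X in _ = `|\det X|).
(* [s] maps 0 to [lift k 0], 1 to [k] and i + 2 to [lift k (i + 1)]. *)
pose s : {perm 'I_(1 + m.+1)} := lift_perm (lift ord0 ord0) k 1.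
have s0 : s ord0 = lift k ord0.
  have -> : ord0 = lift (lift ord0 ord0) ord0 :> 'I_(1 + m.+1) by exact: val_inj.
  by rewrite lift_perm_lift perm1.
have s1 : s (lift ord0 ord0) = k by rewrite lift_perm_id.
have s2 i : s (lift ord0 (lift ord0 i)) = lift k (lift ord0 i).
  have -> : lift ord0 (lift ord0 i) = lift (lift ord0 ord0) (lift ord0 i)
    :> 'I_(1 + m.+1) by exact: val_inj.
  by rewrite lift_perm_lift perm1.
have rB i : row i (row_perm s B) = row_mx 1%:M (p (s i)).
  by apply/rowP => j; rewrite !mxE.
have A0 : row ord0 A = p k - b.
  rewrite (_ : ord0 = @lshift 1 m ord0); last exact: val_inj.
  exact: etrans (rowKu _ _ _) (row_id _ _).
have A1 i : row (lift ord0 i) A = p (lift k (lift ord0 i)) - b.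
  rewrite [in LHS](_ : lift ord0 i = @rshift 1 m i); last exact: val_inj.
  exact: etrans (rowKd _ _ _) (rowK _ _).
have rA i : p (s (lift ord0 i)) = b + row i A.
  by have [j ->|->] := unliftP ord0 i; rewrite ?s1 ?s2 ?A0 ?A1 subrKC.
have sB : row_perm s B =
    block_mx 1%:M 0 (const_mx 1) 1%:M *m block_mx (1%:M : 'M[R]_1) b 0 A.
  rewrite mulmx_block !mul1mx !mulmx1 !mul0mx !addr0.
  apply/row_matrixP => i; rewrite rB block_mxEv.
  have [j ->|->] := unliftP ord0 i.
    rewrite [in RHS](_ : lift ord0 j = @rshift 1 m.+1 j); last exact: val_inj.
    rewrite rowKd row_row_mx rA raddfD/= row_mul; congr (row_mx _ (_ + _)).
      by apply/rowP => l; rewrite !mxE ord1.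
    by rewrite row_const [const_mx 1](_ : _ = 1%:M) ?mul1mx//;
      apply/rowP => l; rewrite !mxE ord1.
  rewrite [in RHS](_ : ord0 = @lshift 1 m.+1 ord0); last exact: val_inj.
  by rewrite rowKu row_row_mx !row_id s0.
have := congr1 (fun X => `|\det X|) sB.
rewrite /= row_permE !det_mulmx det_perm normrM normr_sign mul1r.
by rewrite det_lblock det_ublock !det1 !mul1r => <-.
Qed.

(** Base times height for the simplex itself: [u] is a unit normal of the facet,
    and its product with [p k - b] is the height up to sign. *)
Lemma has_volume_facet (R : realType) (m : nat) (p : 'I_m.+2 -> 'rV[R]_m.+1)
    (k : 'I_m.+2) (u : 'rV[R]_m.+1) (b := p (lift k ord0)) :
  simplex_det p != 0 -> u *m u^T = 1%:M ->
  (forall l, (p (lift k l) - b) *m u^T = 0) ->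
  has_volume m (facet p k)
    (`|simplex_det p| / (`|((p k - b) *m u^T) ord0 ord0| * m`!%:R)).
Proof.
move=> pn0 uu ub; pose E := \matrix_(i < m) (p (lift k (lift ord0 i)) - b).
have detE : `|\det (col_mx (p k - b) E : 'M[R]_(1 + m))| = `|simplex_det p|.
  exact: simplex_det_edges.
have fE : row_free E.
  apply: inj_row_free => v vE.
  have : row_mx (0 : 'rV_1) v *m (col_mx (p k - b) E) = 0.
    by rewrite mul_row_col mul0mx add0r.
  have uD : (col_mx (p k - b) E : 'M[R]_(1 + m)) \in unitmx.
    by rewrite unitmxE unitfE -normr_eq0 detE normr_eq0.
  move/(congr1 (mulmx^~ (invmx (col_mx (p k - b) E : 'M[R]_(1 + m))))).
  by rewrite mulmxK// mul0mx => /eqP; rewrite row_mx_eq0 => /andP[_ /eqP].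
have [T [Q [EE QQ Ttrig T0]]] := gram_schmidt fE.
have dT : 0 < \det T by rewrite det_triangular// prodr_gt0.
have uT : T \in unitmx by rewrite unitmxE unitfE gt_eqF.
have Eu : E *m u^T = 0.
  by apply/row_matrixP => i; rewrite row_mul rowK row0 ub.
have := det_height (p k - b) EE QQ uT uu Eu; rewrite detE (gtr0_norm dT) => ->.
have hn0 : `|((p k - b) *m u^T) ord0 ord0| != 0.
  apply/eqP => h0; move: pn0; rewrite -normr_eq0 -detE.
  by rewrite (det_height _ EE QQ uT uu Eu) h0 mul0r eqxx.
rewrite invfM mulrA (mulrAC _ (\det T)) divff// mul1r.
rewrite /facet conv_hull_based -/b -/E EE; exact: has_volume_simplex.
Qed.

(** * Simplices with given facet volumes *)

Theorem mainTheorem1 (R : realType) (n : nat) (hn : (2 <= n)%N)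
    (z : 'I_n.+1 -> R) (hz : forall k, 0 < z k)
    (hsum : forall k, 2 * z k < \sum_(i < n.+1) z i) :
  exists p : 'I_n.+1 -> 'rV[R]_n,
    nondegenerate_simplex p /\
    forall k : 'I_n.+1, has_volume n.-1 (facet p k) (z k).
Proof.
case: n => [|[|m]] // in hn z hz hsum *.
have [||M [uM rowM sumM]] :=
  @closed_polygon _ m _ _ (hz ord0) (fun i => hz (lift ord0 i)).
- by rewrite -big_ord_recl.
- by move=> i; rewrite -big_ord_recl.
pose d := `|\det M|.
have d0 : 0 < d by rewrite normr_gt0 -unitfE -unitmxE.
(* At scale [c] the facet volumes are z_k c ^+ m.+1 / (d * m.+1`!). *)
have [c c0 cE] : exists2 c : R, 0 < c & c ^+ m.+1 = d * m.+1`!%:R.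
  have x0 : 0 < d * m.+1`!%:R by rewrite mulr_gt0// ltr0n fact_gt0.
  exists ((d * m.+1`!%:R) `^ (m.+1%:R^-1)); first exact: powR_gt0.
  by rewrite -powR_mulrn ?powR_ge0// -powRrM mulVf ?pnatr_eq0// powRr1// ltW.
(* The rows of [P] are a multiple of the basis dual to the rows of [M]. *)
pose P := c *: (invmx M)^T.
have MP : M *m P^T = c%:M.
  by rewrite /P linearZ/= trmxK -scalemxAr mulmxV// scale_scalar_mx mulr1.
have rowMP i j : row i M *m (row j P)^T = (c * (i == j)%:R)%:M.
  rewrite [LHS]mx11_scalar; congr _%:M.
  rewrite [RHS]mulr_natr; have /matrixP/(_ i j) := MP; rewrite !mxE => <-.
  by apply: eq_bigr => l _; rewrite !mxE.
pose p (l : 'I_m.+3) := if unlift ord0 l is Some j then row j P else 0.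
pose N (k : 'I_m.+3) :=
  if unlift ord0 k is Some i then row i M else - (const_mx 1 *m M).
have Np k l : N k *m (p l)^T = (c * ((k == l)%:R - (k == ord0)%:R))%:M.
  rewrite /N /p; have [i ->|->] := unliftP ord0 k; last first.
    have [j ->|->] := unliftP ord0 l; last first.
      by rewrite trmx0 mulmx0 subrr mulr0 raddf0.
    rewrite mulNmx [const_mx 1 *m M]mulmx_sum_row mulmx_suml.
    rewrite (bigD1 j)//= big1 => [|i ij].
      rewrite mxE scale1r rowMP eqxx addr0.
      by rewrite -raddfN; congr _%:M; rewrite sub0r mulrN.
    by rewrite -scalemxAl rowMP (negPf ij) mulr0 raddf0 scaler0.
  have [j ->|->] := unliftP ord0 l; last first.
    by rewrite trmx0 mulmx0 subrr mulr0 raddf0.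
  by rewrite rowMP (inj_eq lift_inj) (eq_sym _ ord0) (negPf (neq_lift _ _)) subr0.
have NN k : N k *m (N k)^T = (z k ^+ 2)%:M.
  rewrite /N; have [i ->|->] := unliftP ord0 k; first exact: rowM.
  by rewrite linearN/= mulNmx mulmxN opprK sumM.
have detp : `|simplex_det p| = c ^+ m.+2 / d.
  have -> : simplex_det p = \det P.
    rewrite -[RHS]mul1r -{1}(det1 R 1) -(@det_lblock _ 1 m.+2 _ (const_mx 1)).
    congr (\det _); apply/row_matrixP => i; rewrite rowK /p.
    have [j ->|->] := unliftP ord0 i.
      rewrite [in RHS](_ : lift ord0 j = @rshift 1 m.+2 j); last exact: val_inj.
      rewrite block_mxEv rowKd row_row_mx; congr row_mx.
      by apply/rowP => l; rewrite !mxE ord1.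
    rewrite [in RHS](_ : ord0 = @lshift 1 m.+2 ord0); last exact: val_inj.
    by rewrite block_mxEv rowKu row_row_mx !row_id.
  have /(congr1 (fun X => `|\det X|)) := MP.
  rewrite det_mulmx det_tr normrM det_scalar normrX (gtr0_norm c0) -/d => <-.
  by rewrite mulrAC divff ?mul1r// gt_eqF.
have pn0 : simplex_det p != 0.
  by rewrite -normr_eq0 detp mulf_neq0 ?invr_eq0 ?expf_neq0// gt_eqF.
exists p; split; first exact: nondegenerate_simplex_det.
move=> k; pose u := (z k)^-1 *: N k.
have zn0 : z k != 0 by rewrite gt_eqF.
have pu l l' :
    (p l - p l') *m u^T = (c / z k * ((k == l)%:R - (k == l')%:R))%:M.
  rewrite -[LHS]trmxK trmx_mul trmxK /u -scalemxAl raddfB/= mulmxBr !Np.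
  by rewrite -raddfB/= scale_scalar_mx tr_scalar_mx; congr _%:M; ring.
have uu : u *m u^T = 1%:M.
  rewrite /u linearZ/= -scalemxAl -scalemxAr NN !scale_scalar_mx.
  by rewrite expr2 !mulKf// mulVf.
have := @has_volume_facet _ _ p k u pn0 uu.
rewrite pu eqxx (negPf (neq_lift _ _)) subr0 mulr1 mxE eqxx mulr1n.
rewrite detp gtr0_norm ?divr_gt0// exprS cE.
rewrite (_ : _ / _ / _ = z k); last first.
  by field; rewrite zn0 !gt_eqF// ltr0n fact_gt0.
by apply => l; rewrite pu !(negPf (neq_lift _ _)) subrr mulr0 raddf0.
Qed.
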